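(* Let $L_{\mathcal L}\subseteq\{0,1\}^*$ be the set of all binary words that are Lyndon words with respect to the order $0<1$, together with all words obtained from these by exchanging $0$ and $1$. Then $\mathcal G_{L_{\mathcal L}}$ includes every graph.
   Context: Given a linear order $\prec$ on an alphabet $\Sigma$, it is extended to the lexicographic order on $\Sigma^*$: $u\prec w$ iff $u$ is a (proper) prefix of $w$, or $u=x\mathtt a y_2$, $w=x\mathtt b y_1$ for letters $\mathtt a\prec\mathtt b$ and words $x,y_1,y_2$. The conjugates of a word $uv$ are the words $vu$. A word $w$ is primitive if there are no word $u$ and $k\ge2$ with $w=u^k$. A primitive word is a Lyndon word if it is the lexicographically smallest element among its conjugates. Graphs are finite, undirected and simple: $G=(V,E)$ with $V$ a finite non-empty set and $E\subseteq\binom{V}{2}$. A language $L\subseteq\{0,1\}^*$ is $0$-$1$-symmetric if it is invariant under the morphism exchanging $0$ and $1$ (the language here is). For distinct letters $u,v$ of an alphabet $V$, $h_{u,v}:V^*\to\{0,1\}^*$ is the monoid morphism with $u\mapsto 0$, $v\mapsto 1$, and $x\mapsto\lambda$ (empty word) for all other letters $x$. For a $0$-$1$-symmetric $L$ and a word $w\in V^*$ in which every letter of $V$ occurs, $G(L,w)$ is the graph with vertex set $V$ in which distinct $u,v$ are adjacent if and only if $h_{u,v}(w)\in L$. $\mathcal G_L$ is the class of all graphs $G=(V,E)$ with $G=G(L,w)$ for some $w\in V^*$ in which every letter of $V$ occurs. *)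

(* Defs.v *)
From mathcomp Require Import all_boot all_order.

Set Implicit Arguments.
Unset Strict Implicit.
Unset Printing Implicit Defensive.

Definition word_power (A : Type) (u : seq A) (k : nat) : seq A :=
  flatten (nseq k u).

(* The empty word is its own square, hence not primitive. *)
Definition primitive_word (A : Type) (w : seq A) : Prop :=
  ~ exists (u : seq A) (k : nat), 2 <= k /\ w = word_power u k.

Definition conjugate_words (A : Type) (w w' : seq A) : Prop :=
  exists u v : seq A, w = u ++ v /\ w' = v ++ u.

(* [seqlexi A] is [seq A] with the lexicographic order, in which a proper
   prefix of a word is smaller than that word. *)
Definition lyndon (d : Order.disp_t) (A : orderType d) (w : seq A) : Prop :=
  primitive_word w /\
  forall w' : seq A, conjugate_words w w' -> ((w : seqlexi A) <= w')%O.

(* The letter 0 is [false] and the letter 1 is [true], so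
   that [false < true] in the order on [bool]. *)

Definition exchange (w : seq bool) : seq bool := map negb w.

Record sym_language := SymLanguage {
  lang :> seq bool -> Prop;
  lang_exchange : forall w : seq bool, lang (exchange w) <-> lang w
}.

Lemma exchangeK : involutive exchange.
Proof. exact: (mapK negbK). Qed.

Definition lyndon_words_or_exchanged (w : seq bool) : Prop :=
  lyndon w \/ exists2 x : seq bool, lyndon x & w = exchange x.

Lemma lyndon_words_or_exchanged_sym (w : seq bool) :
  lyndon_words_or_exchanged (exchange w) <-> lyndon_words_or_exchanged w.
Proof.
have half (x : seq bool) :
    lyndon_words_or_exchanged x -> lyndon_words_or_exchanged (exchange x).
  case=> [Lx | [y Ly ->]]; first by right; exists x.
  by left; rewrite exchangeK.
by split=> [/half|/half //]; rewrite exchangeK.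
Qed.

Definition lyndon_language : sym_language :=
  SymLanguage lyndon_words_or_exchanged_sym.

Record sgraph := SGraph {
  vertex :> finType;
  adj : rel vertex;
  vertex_nonempty : 0 < #|vertex|;
  adj_sym : symmetric adj;
  adj_irrefl : irreflexive adj
}.

(* The monoid morphism h_{u,v}, for distinct u and v. *)
Definition proj_letter (V : eqType) (u v x : V) : seq bool :=
  if x == u then [:: false] else if x == v then [:: true] else [::].

Definition proj_word (V : eqType) (u v : V) (w : seq V) : seq bool :=
  flatten (map (proj_letter u v) w).

(* G = G(L, w).  Both graphs have the vertex set of G and no loops, so the
   equality amounts to the same adjacency between distinct vertices. *)
Definition is_word_graph (L : sym_language) (G : sgraph) (w : seq G) : Prop :=
  forall u v : G, u != v -> (adj u v <-> L (proj_word u v w)).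

Definition graph_class (L : sym_language) (G : sgraph) : Prop :=
  exists w : seq G, (forall v : G, v \in w) /\ is_word_graph L w.

(* Main.v *)
Require Import Defs.
From mathcomp Require Import all_boot all_order.

(** Fix an enumeration [s] of the vertices and project a pair [u] before [v]
    with [u] as 0 and [v] as 1.  The word starts with the fourth powers of all
    vertices, which project to 0000 1111, followed by one gadget
    [a a X a a S] for every nonadjacent pair [a] before [b], where [S] is [s]
    and [X] is [s] without [a] and [b].  Since [X] vanishes only on the pair
    [a, b], the gadget projects to 000001 on that pair, and otherwise to a word
    ending in 1 with at most three consecutive 0s.  A word 00001... ending in 1
    all of whose later runs of 0s are shorter is Lyndon, whereas a run of five
    0s yields a smaller conjugate. *)

Set Implicit Arguments.
Unset Strict Implicit.
Unset Printing Implicit Defensive.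

Import Order.TTheory.

(* Preceded by [c] letters 0, the word [s] has only runs of at most [k] letters
   0, each of them followed by a letter 1. *)
Fixpoint short_runs (k c : nat) (s : seq bool) : bool :=
  match s with
  | [::] => c == 0
  | true :: s' => short_runs k 0 s'
  | false :: s' => (c < k) && short_runs k c.+1 s'
  end.

(** The test accepts [s] only if it leaves no run of 0s open, so the count is back at 0 at the
    junction. *)
Lemma short_runs_cat k c s t :
  short_runs k c s -> short_runs k 0 t -> short_runs k c (s ++ t).
Proof.
elim: s c => [|[] s IHs] c /=; first by move/eqP->.
- exact: IHs.
- by case/andP=> -> /IHs H /H.
Qed.

Lemma short_runs_flatten k (ss : seq (seq bool)) :
  all (short_runs k 0) ss -> short_runs k 0 (flatten ss).
Proof.
by elim: ss => //= s ss IHss /andP[Hs /IHss]; apply: short_runs_cat.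
Qed.

Lemma short_runs_nseq k a s :
  a <= k -> short_runs k 0 s -> short_runs k 0 (nseq a false ++ true :: s).
Proof.
move=> le_ak Hs; have {le_ak}: 0 + a <= k by [].
elim: a 0 => //= a IHa c; rewrite addnS => lt_ca.
by rewrite (leq_ltn_trans (leq_addr a c) lt_ca) IHa.
Qed.

Lemma short_runs_suffix k s t c :
  c <= k -> short_runs k c (s ++ t) -> exists2 c', c' <= k & short_runs k c' t.
Proof.
elim: s c => [|[] s IHs] c le_ck /=; first by exists c.
- exact: IHs.
- by case/andP=> lt_ck; apply: IHs.
Qed.

Lemma short_runs_head k c s :
    c <= k -> short_runs k c s -> s != [::] ->
  exists a s', c + a <= k /\ s = nseq a false ++ true :: s'.
Proof.
elim: s c => // -[] s IHs c le_ck /=; first by exists 0, s; rewrite addn0.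
case/andP=> lt_ck Hs _.
have s_neq0 : s != [::] by case: (s) Hs.
have [a [s' [le_ca ->]]] := IHs _ lt_ck Hs s_neq0.
by exists a.+1, s'; rewrite addnS.
Qed.

(** The words first differ at position [a], where the run of length [k] still has a 0. *)
Lemma ltxi_long_run k a (s t : seq bool) :
  a < k -> ((nseq k false ++ s : seqlexi bool) < nseq a false ++ true :: t)%O.
Proof.
elim: a k => [|a IHa] [|k] //= lt_ak; rewrite ltxi_cons ?lexx //=.
exact: IHa.
Qed.

(** Strictness forces primitivity: a word [x] repeated at least twice is unchanged when its first
    factor [x] is rotated to the end. *)
Lemma lyndon_of_lt_conjugates (w : seq bool) :
    w != [::] ->
    (forall u v, w = u ++ v -> u != [::] -> v != [::] ->
      ((w : seqlexi bool) < v ++ u)%O) ->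
  lyndon w.
Proof.
move=> w_neq0 Hw; split=> [[x [[|[|k]] [//= _ def_w]]]|_ [u [v [def_w ->]]]].
- have x_neq0 : x != [::].
    apply: contraNneq w_neq0 => x0.
    by rewrite def_w x0 /word_power; elim: (k.+2).
  have rotE : word_power x k.+1 ++ x = w.
    rewrite def_w /word_power; elim: (k.+1) => [|n IHn] /=.
      by rewrite cats0.
    by rewrite -catA IHn.
  have := Hw x (word_power x k.+1) def_w x_neq0.
  by rewrite rotE ltxx /word_power /=; case: (x) x_neq0 => // ? ? _ /(_ isT).
- have [u0|u_neq0] := eqVneq u [::]; first by rewrite def_w u0 cats0.
  have [v0|v_neq0] := eqVneq v [::]; first by rewrite def_w v0 cats0.
  exact/ltW/Hw.
Qed.

Lemma lyndon_long_first_run k (s : seq bool) :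
  short_runs k 0 s -> lyndon (nseq k.+1 false ++ true :: s).
Proof.
move=> Hs; apply: lyndon_of_lt_conjugates => // -[|b u] // v [_ def_uv] _ v_neq0.
(* A proper suffix misses the first 0, so it is a suffix of a word whose runs have length at most
   [k], and it reaches a 1 sooner than the whole word does. *)
have := short_runs_nseq (leqnn k) Hs; rewrite def_uv.
case/(short_runs_suffix (leq0n k)) => c le_ck Hv.
have [a [v' [le_ca ->]]] := short_runs_head le_ck Hv v_neq0.
rewrite -catA.
by apply: ltxi_long_run; rewrite ltnS (leq_trans (leq_addl c a)).
Qed.

(** Rotating the longer run to the front gives a smaller conjugate. *)
Lemma not_lyndon_longer_run k a (s p t : seq bool) :
    k < a -> nseq k false ++ true :: s = p ++ nseq a false ++ t ->
  ~ lyndon (nseq k false ++ true :: s).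
Proof.
move=> lt_ka def_w [_ min_w].
have /min_w : conjugate_words (nseq k false ++ true :: s)
    ((nseq a false ++ t) ++ p) by exists p, (nseq a false ++ t).
by rewrite leNgt -catA ltxi_long_run.
Qed.

Lemma not_lyndon_one_zero (s p t : seq bool) :
  true :: s = p ++ false :: t -> ~ lyndon (true :: s).
Proof.
move=> def_w [_ min_w].
have /min_w // : conjugate_words (true :: s) ((false :: t) ++ p).
by exists p, (false :: t).
Qed.

(** The exchanged word starts with 1 and contains a 0, so it has a smaller conjugate starting with
    0. *)
Lemma lyndon_or_exchanged_zero_run k (s : seq bool) :
  lyndon_words_or_exchanged (nseq k.+1 false ++ true :: s)
    <-> lyndon (nseq k.+1 false ++ true :: s).
Proof.
split=> [[//|[x Lx /(congr1 exchange)]]|]; last by left.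
rewrite exchangeK /exchange map_cat => def_x.
rewrite -{}def_x in Lx.
by case: (@not_lyndon_one_zero _ (map negb (nseq k.+1 false)) _ erefl Lx).
Qed.

Section Projection.

Variable V : eqType.
Implicit Types (u v a b : V) (s w : seq V).

Lemma proj_word_cat u v w1 w2 :
  proj_word u v (w1 ++ w2) = proj_word u v w1 ++ proj_word u v w2.
Proof. by rewrite /proj_word map_cat flatten_cat. Qed.

Lemma proj_word_flatten u v (ws : seq (seq V)) :
  proj_word u v (flatten ws) = flatten (map (proj_word u v) ws).
Proof. by elim: ws => //= w ws IHws; rewrite proj_word_cat IHws. Qed.

Lemma proj_word_filter u v w :
  proj_word u v w = [seq x != u | x <- w & pred2 u v x].
Proof.
elim: w => //= x w IHw; rewrite /proj_word /= -/(proj_word u v w) IHw.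
rewrite /proj_letter; have [->|x_neq_u] /= := eqVneq x u; first by rewrite eqxx.
by case: eqP => //= _; rewrite x_neq_u.
Qed.

Lemma proj_word_exchange u v w :
  u != v -> proj_word v u w = exchange (proj_word u v w).
Proof.
move=> u_neq_v; rewrite /exchange /proj_word map_flatten -map_comp.
congr flatten; apply: eq_map => x; rewrite /= /proj_letter.
have [->|] := eqVneq x u; first by rewrite (negPf u_neq_v).
by case: (x == v).
Qed.

Lemma filter_pred2_uniq s u v :
    uniq s -> v \in s -> index u s < index v s ->
  filter (pred2 u v) s = [:: u; v].
Proof.
elim: s => //= x s IHs /andP[xNs uniq_s]; rewrite inE ![_ == x]eq_sym.
have [//|x_neq_v /=] := eqVneq x v.
have [x_u v_s _|x_neq_u /= v_s lt_uv] := eqVneq x u.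
- congr (_ :: _) => //; rewrite -(filter_pred1_uniq uniq_s v_s).
  apply: eq_in_filter => y y_s /=.
  by have [y_u|//] := eqVneq y u; rewrite -x_u in y_u; rewrite -y_u y_s in xNs.
- exact: IHs.
Qed.

Definition gadget s a b :=
  [:: a; a] ++ filter (predC (pred2 a b)) s ++ [:: a; a] ++ s.

Definition fourth_powers s := flatten [seq nseq 4 x | x <- s].

Variables (s : seq V) (u v : V).
Hypotheses (uniq_s : uniq s) (v_s : v \in s) (lt_uv : index u s < index v s).

Let v_neq_u : v != u.
Proof. by apply: contraTneq lt_uv => ->; rewrite ltnn. Qed.

Lemma proj_fourth_powers :
  proj_word u v (fourth_powers s) = nseq 4 false ++ nseq 4 true.
Proof.
have -> : proj_word u v (fourth_powers s)
    = proj_word u v (fourth_powers (filter (pred2 u v) s)).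
  rewrite /fourth_powers !proj_word_flatten -!map_comp.
  elim: (s) => //= x s' ->; case: ifP => //= /norP[/negPf xNu /negPf xNv].
  by rewrite /proj_word /= /proj_letter xNu xNv.
rewrite filter_pred2_uniq // /fourth_powers /proj_word /= /proj_letter.
by rewrite !eqxx (negPf v_neq_u).
Qed.

Lemma proj_gadget a b :
  proj_word u v (gadget s a b) =
  proj_word u v [:: a; a]
    ++ [seq x != u | x <- [:: u; v] & predC (pred2 a b) x]
    ++ proj_word u v [:: a; a] ++ [:: false; true].
Proof.
rewrite /gadget !proj_word_cat; congr (_ ++ (_ ++ (_ ++ _))).
(* Removing [a] and [b] commutes with erasing all letters but [u] and [v]. *)
- rewrite proj_word_filter -(filter_pred2_uniq uniq_s v_s lt_uv) -!filter_predI.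
  by congr map; apply: eq_filter => x /=; rewrite andbC.
- by rewrite proj_word_filter filter_pred2_uniq //= eqxx v_neq_u.
Qed.

Lemma proj_gadget_same :
  proj_word u v (gadget s u v) = nseq 5 false ++ [:: true].
Proof.
by rewrite proj_gadget /proj_word /proj_letter /= !eqxx /= orbT.
Qed.

(** If [a = u], then [v] survives in the middle block and the projection is 00 1 00 01. If [a = v],
    the order excludes [b = u] and it is 11 0 11 01. Otherwise the doubled letters vanish, leaving a
    subsequence of 01 followed by 01. *)
Lemma proj_gadget_other a b :
    index a s < index b s -> (a, b) != (u, v) ->
  short_runs 3 0 (proj_word u v (gadget s a b)).
Proof.
move=> lt_ab; rewrite xpair_eqE proj_gadget /proj_word /proj_letter /=.
have [->|aNu] /= := eqVneq a u.
  rewrite [b == v]eq_sym (negPf v_neq_u) => /negPf ->.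
  by rewrite /= v_neq_u.
have [a_v _|aNv _] := eqVneq a v.
  have uNb : u != b.
    by apply: contraTneq lt_ab => <-; rewrite a_v -leqNgt ltnW.
  by rewrite uNb /= eqxx.
by case: (u == b); case: (v == b); rewrite /= ?eqxx ?v_neq_u.
Qed.

End Projection.

Section GraphWord.

Variable G : sgraph.
Implicit Types u v : G.

(** The earlier vertex comes first, so the letter doubled in a gadget is the one that its own pair
    projects to 0. *)
Definition nonadjacent_pairs : seq (G * G) :=
  [seq p <- enum {: G * G} |
    (index p.1 (enum G) < index p.2 (enum G)) && ~~ adj p.1 p.2].

Definition graph_word : seq G :=
  fourth_powers (enum G)
    ++ flatten [seq gadget (enum G) p.1 p.2 | p <- nonadjacent_pairs].

Lemma mem_graph_word v : v \in graph_word.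
Proof.
rewrite mem_cat; apply/orP; left; apply/flattenP; exists (nseq 4 v).
  by apply: map_f; rewrite mem_enum.
by rewrite mem_nseq eqxx.
Qed.

Lemma adj_graph_word u v :
    index u (enum G) < index v (enum G) ->
  adj u v <-> lyndon_language (proj_word u v graph_word).
Proof.
move=> lt_uv; have uniq_s := enum_uniq G.
have v_s : v \in enum G by rewrite mem_enum.
set t := [seq proj_word u v (gadget (enum G) p.1 p.2) | p <- nonadjacent_pairs].
have -> : proj_word u v graph_word
    = nseq 4 false ++ true :: nseq 3 true ++ flatten t.
  rewrite proj_word_cat proj_fourth_powers // -catA proj_word_flatten.
  by rewrite -map_comp.
apply: iff_trans (iff_sym (lyndon_or_exchanged_zero_run 3 _)).
split=> [adj_uv|Lw].
- apply: lyndon_long_first_run; apply: short_runs_cat => //.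
  apply/short_runs_flatten/allP => _ /mapP[[a b] + ->].
  rewrite mem_filter => /andP[/andP[/= lt_ab Nadj_ab] _].
  apply: proj_gadget_other => //.
  by apply: contraNneq Nadj_ab => -[-> ->].
- apply/negPn/negP => Nadj_uv.
  have uv_in : (u, v) \in nonadjacent_pairs.
    by rewrite mem_filter /= lt_uv Nadj_uv mem_enum.
  have [p [q def_t]] : exists p q, flatten t = p ++ nseq 5 false ++ q.
    rewrite /t; case/splitPr: uv_in => p1 p2.
    rewrite map_cat flatten_cat /= proj_gadget_same //.
    by eexists; eexists; rewrite -catA.
  (* The five 0s of the pair's own gadget beat the four initial 0s. *)
  apply: (@not_lyndon_longer_run 4 5 _ (nseq 4 false ++ nseq 4 true ++ p) q) Lw.
    by [].
  by rewrite def_t.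
Qed.

End GraphWord.

Theorem theorem25 (G : sgraph) : graph_class lyndon_language G.
Proof.
exists (graph_word G); split=> [v|u v u_neq_v]; first exact: mem_graph_word.
case: (ltngtP (index u (enum G)) (index v (enum G))) => [||eq_uv].
- exact: adj_graph_word.
(* Swapping the vertices exchanges 0 and 1 in the projection, which preserves membership in the
   language. *)
- move=> lt_vu; rewrite adj_sym; apply: iff_trans (adj_graph_word lt_vu) _.
  by rewrite (proj_word_exchange _ u_neq_v); apply: lang_exchange.
- by case/eqP: u_neq_v; apply: (index_inj u _ _ eq_uv); rewrite ?mem_enum.
Qed.
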